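(* For all positive integers $m,n,r$, $$p(mn,mr)\le p'(n,r).$$
   Context: A hypergraph is a pair $(V,E)$ where $V$ is a finite set (of vertices) and $E$ is a family of subsets of $V$ (edges). It is $n$-uniform if every edge has size $n$. A vertex $r$-coloring is a map $V\to\{1,\dots,r\}$; it is called panchromatic if every edge contains a vertex of every one of the $r$ colors. $p(n,r)$ denotes the minimal number of edges of an $n$-uniform hypergraph that has no panchromatic $r$-coloring. $p'(n,r)$ denotes the minimal number of edges of an $n$-uniform hypergraph $H=(V,E)$ (over all finite vertex sets $V$) such that every subset $V'\subset V$ with $|V'|\ge\left\lceil\frac{r-1}{r}|V|\right\rceil$ contains an edge of $H$ (as a subset). A minimum over an empty set of hypergraphs is understood as $+\infty$ (this only matters in the degenerate case of one color). *)

(* Defs.v *)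
From mathcomp Require Import all_boot all_order all_algebra.
From mathcomp Require Import boolp constructive_ereal.

Set Implicit Arguments.
Unset Strict Implicit.
Unset Printing Implicit Defensive.

Import Order.TTheory GRing.Theory Num.Theory.
Local Open Scope ring_scope.

(* Minimum of a set of natural numbers, with the convention min(empty) = +oo. *)
Definition min_nat (A : nat -> Prop) : \bar int :=
  match pselect (exists k, `[< A k >]) with
  | left exA => (Posz (ex_minn exA))%:E
  | right _ => +oo%E
  end.

Lemma min_nat_empty (A : nat -> Prop) :
  (forall k, ~ A k) -> min_nat A = +oo%E.
Proof.
move=> A0; rewrite /min_nat; case: pselect => [exA|//].
by exfalso; case: exA => k /asboolP /A0.
Qed.

Lemma min_natP (A : nat -> Prop) (k : nat) :
  A k -> (forall j, A j -> (k <= j)%N) -> min_nat A = (Posz k)%:E.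
Proof.
move=> Ak mink; rewrite /min_nat; case: pselect => [exA|[]]; last first.
  by exists k; apply/asboolP.
case: ex_minnP => j /asboolP Aj minj; congr (Posz _)%:E.
by apply/eqP; rewrite eqn_leq mink // minj //; apply/asboolP.
Qed.

(* A hypergraph on the vertex set V is given by its set E of edges. *)
Definition uniform (V : finType) (E : {set {set V}}) (n : nat) : Prop :=
  forall e, e \in E -> #|e| = n.

Definition panchromatic (V : finType) (E : {set {set V}}) (r : nat)
    (f : V -> 'I_r) : Prop :=
  forall e, e \in E -> forall c : 'I_r, exists2 v, v \in e & f v = c.

Definition p (n r : nat) : \bar int :=
  min_nat (fun k => exists (V : finType) (E : {set {set V}}),
    [/\ uniform E n,
        ~ (exists f : V -> 'I_r, panchromatic E f)
      & #|E| = k]).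

Definition large_sets_contain_edge (V : finType) (E : {set {set V}})
    (r : nat) : Prop :=
  forall V' : {set V},
    Num.ceil ((r%:R - 1) / r%:R * #|V|%:R : rat) <= Posz #|V'| ->
    exists2 e, e \in E & e \subset V'.

Definition p' (n r : nat) : \bar int :=
  min_nat (fun k => exists (V : finType) (E : {set {set V}}),
    [/\ uniform E n,
        large_sets_contain_edge E r
      & #|E| = k]).

(* Main.v *)
Require Import Defs.
From mathcomp Require Import all_boot all_order all_algebra.
From mathcomp Require Import constructive_ereal.
From mathcomp Require Import boolp lra.

(** Take an [n]-uniform hypergraph on [V] all of whose large vertex sets contain
    an edge, and blow each vertex up into [m] copies: an edge [e] becomes
    [e x 'I_m], which has [m * n] vertices, and the number of edges is kept.
    The blown-up hypergraph has no panchromatic coloring with [m * r] colors.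
    Indeed, in such a coloring every color class would meet every [e x 'I_m], so
    its projection to [V] would be a transversal of the original hypergraph.
    The complement of a transversal contains no edge, hence is not large, so a
    transversal has more than [#|V| / r] vertices ([card_transversal_gt]).
    The [m * r] disjoint color classes would then have more than [m * #|V|]
    vertices in total, which is the size of the whole blown-up vertex set. *)

Set Implicit Arguments.
Unset Strict Implicit.
Unset Printing Implicit Defensive.

Import Order.TTheory GRing.Theory Num.Theory.

Lemma sub_min_nat (A B : nat -> Prop) :
  (forall k, A k -> B k) -> (min_nat B <= min_nat A)%E.
Proof.
move=> AB; have [exA|nexA] := pselect (exists k, A k); last first.
  by rewrite (@min_nat_empty A) ?leey // => k Ak; apply: nexA; exists k.
have exA' : exists k, `[< A k >] by case: exA => k Ak; exists k; apply/asboolP.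
have [a /asboolP Aa mina] := ex_minnP exA'.
have exB' : exists k, `[< B k >] by exists a; apply/asboolP/AB.
have [b /asboolP Bb minb] := ex_minnP exB'.
rewrite (min_natP Aa) => [|j Aj]; last by apply/mina/asboolP.
rewrite (min_natP Bb) => [|j Bj]; last by apply/minb/asboolP.
by rewrite lee_fin lez_nat; apply/minb/asboolP/AB.
Qed.

(** The complement of a transversal contains no edge, so it has size below the
    threshold [(r - 1) / r * #|V|]; the ceiling in that threshold is harmless
    because the size is an integer. *)
Lemma card_transversal_gt {V : finType} {E : {set {set V}}} {r : nat}
    {T : {set V}} :
  0 < r -> large_sets_contain_edge E r ->
  (forall e, e \in E -> exists2 v, v \in e & v \in T) -> #|V| < r * #|T|.
Proof.
move=> r_gt0 largeE transT; rewrite ltnNge; apply/negP => small_T.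
have [|e eE eT] := largeE (~: T).
  rewrite ceil_le_int mulrAC ler_pdivrMr ?ltr0n // -pmulrn -(cardsC T).
  move: small_T; rewrite -(cardsC T) -(ler_nat rat) natrM natrD.
  by nra.
have [v ve vT] := transT e eE.
by have := subsetP eT v ve; rewrite inE vT.
Qed.

Definition blowup {V : finType} (m : nat) (e : {set V}) : {set V * 'I_m} :=
  setX e [set: 'I_m].

Lemma card_blowup (V : finType) m (e : {set V}) : #|blowup m e| = m * #|e|.
Proof. by rewrite cardsX cardsT card_ord mulnC. Qed.

Lemma blowup_inj (V : finType) m : 0 < m -> injective (@blowup V m).
Proof.
move=> m_gt0 e1 e2 /setP eq_e; apply/setP => v.
by have := eq_e (v, Ordinal m_gt0); rewrite !in_setX !in_setT !andbT.
Qed.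

Lemma blowup_not_panchromatic (V : finType) (E : {set {set V}}) m r
    (f : V * 'I_m -> 'I_(m * r)) :
  0 < m -> 0 < r -> large_sets_contain_edge E r ->
  ~ panchromatic (blowup m @: E) f.
Proof.
move=> m_gt0 r_gt0 largeE panf.
pose C c := [set x | f x == c].
have large_class c : #|V| < r * #|C c|.
  apply: leq_trans (leq_mul (leqnn r) (leq_imset_card fst (C c))).
  apply: card_transversal_gt r_gt0 largeE _ => e eE.
  have [[v i] + fx] := panf _ (imset_f _ eE) c.
  rewrite /blowup in_setX => /andP[ve _]; exists v => //.
  by apply/imsetP; exists (v, i); rewrite // inE fx.
have card_classes : \sum_c #|C c| = #|V| * m.
  transitivity #|{: V * 'I_m}|; last by rewrite card_prod card_ord.
  rewrite -[RHS]sum1_card (partition_big f xpredT) //.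
  by apply: eq_bigr => c _; rewrite -sum1dep_card.
have : \sum_(c < m * r) #|V|.+1 <= \sum_c r * #|C c|.
  by apply: leq_sum => c _; apply: large_class.
rewrite -big_distrr /= card_classes sum_nat_const card_ord.
by rewrite mulnCA (mulnC r) mulnC leq_pmul2r ?ltnn // muln_gt0 m_gt0.
Qed.

Theorem theorem1p6 (m n r : nat) (m_gt0 : (0 < m)%N) (n_gt0 : (0 < n)%N)
    (r_gt0 : (0 < r)%N) :
  (p (m * n)%N (m * r)%N <= p' n r)%E.
Proof.
apply: sub_min_nat => k [V [E [unifE largeE <-]]].
exists (V * 'I_m)%type, (blowup m @: E); split.
- by move=> _ /imsetP[e eE ->]; rewrite card_blowup unifE.
- by case=> f; apply: blowup_not_panchromatic.
- exact/card_imset/blowup_inj.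
Qed.
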